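(* Let $D_0$ be the edge-ordered graph on the four vertices $a,b,v,w$ with exactly the five edges $ab,av,aw,bw,bv$, ordered by $l(ab)<l(av)<l(aw)<l(bw)<l(bv)$. Then \[ssat_e(n,D_0)\ \le\ sat_e(n,D_0)=O\left(n\,\frac{\log n}{\log\log n}\right).\]
   Context: An edge-ordered graph is a finite simple graph together with a linear order on its edge set given by an injective labeling $l$ to $\mathbb{N}$ or $\mathbb{R}$. An edge-ordered graph $H$ contains $G$ (has a copy of $G$) if $G$ is isomorphic, by an isomorphism respecting the edge-order, to a subgraph of $H$ with the induced order; otherwise $H$ is $G$-free. $ssat_e(n,G)$ is the minimum number of edges in an edge-ordered graph $H$ on $n$ vertices such that adding to $H$ any missing edge, inserted at an arbitrary position of the linear order of the edges, creates a new copy of $G$ (one using the added edge); that is, for every missing edge and every position a new copy is created. $sat_e(n,G)$ is defined in the same way with the additional requirement that $H$ is $G$-free. Asymptotic notation is for $n\to\infty$. *)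

(* Defs.v *)
From HB Require Import structures.
From mathcomp Require Import all_boot.
From mathcomp Require Import boolp classical_sets.
From mathcomp Require Import finset.

Set Implicit Arguments.
Unset Strict Implicit.
Unset Printing Implicit Defensive.

(* The labels serve only to order the edges; the value of [lab] outside       *)
(* [edges] is irrelevant.                                                     *)
Record eograph (T : finType) := EOGraph {
  edges : {set {set T}};
  lab : {set T} -> nat;
  card_edge : forall e, e \in edges -> #|e| = 2;
  lab_inj : {in edges &, injective lab}
}.

Section Copies.
Variables T V : finType.

Definition is_copy (G : eograph T) (H : eograph V) (f : T -> V) : Prop :=
  [/\ injective f,
      {in edges G, forall d : {set T}, f @: d \in edges H} &
      {in edges G &, forall d1 d2 : {set T},
        (lab H (f @: d1) < lab H (f @: d2)) = (lab G d1 < lab G d2)}].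

Definition contains (H : eograph V) (G : eograph T) : Prop :=
  exists f, is_copy G H f.

Definition contains_using (H : eograph V) (G : eograph T) (e : {set V}) : Prop :=
  exists2 f, is_copy G H f & exists2 d, d \in edges G & f @: d = e.

(* [H'] is [H] with the new edge [e] inserted somewhere in the edge order. It *)
(* may relabel the old edges as long as their relative order is kept, so that *)
(* every position is available even though labels are natural numbers.        *)
Definition insertion (H : eograph V) (e : {set V}) (H' : eograph V) : Prop :=
  edges H' = e |: edges H /\
  {in edges H &, forall e1 e2, (lab H' e1 < lab H' e2) = (lab H e1 < lab H e2)}.

Definition semisaturated (G : eograph T) (H : eograph V) : Prop :=
  forall (e : {set V}) (H' : eograph V),
    #|e| = 2 -> e \notin edges H -> insertion H e H' -> contains_using H' G e.

Definition saturated (G : eograph T) (H : eograph V) : Prop :=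
  ~ contains H G /\ semisaturated G H.

End Copies.

Definition is_min_size (n : nat) (P : eograph 'I_n -> Prop) (m : nat) : Prop :=
  (exists2 H, P H & #|edges H| = m) /\ (forall H, P H -> m <= #|edges H|).

(* The minimum exists whenever [P] is satisfiable, see [min_sizeP]; lemmas    *)
(* [ssat_eP] and [sat_eP] below show that this is so for [ssat_e], and for    *)
(* [sat_e] as soon as [G] has an edge.                                        *)
Definition min_size (n : nat) (P : eograph 'I_n -> Prop) : nat :=
  xget 0 [set m | is_min_size P m]%classic.

Definition ssat_e (n : nat) (T : finType) (G : eograph T) : nat :=
  min_size (@semisaturated T 'I_n G).

Definition sat_e (n : nat) (T : finType) (G : eograph T) : nat :=
  min_size (@saturated T 'I_n G).

Lemma min_sizeP n (P : eograph 'I_n -> Prop) :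
  (exists H, P H) -> is_min_size P (min_size P).
Proof.
move=> [H0 PH0].
have ex : exists m, `[< exists2 H, P H & #|edges H| = m >].
  by exists #|edges H0|; apply/asboolP; exists H0.
case: (ex_minnP ex) => m /asboolP mP mmin.
have Pm : is_min_size P m.
  by split=> // H PH; apply: mmin; apply/asboolP; exists H.
exact: (xgetPex 0 (ex_intro _ m Pm)).
Qed.

Lemma ssat_eP n (T : finType) (G : eograph T) :
  is_min_size (@semisaturated T 'I_n G) (ssat_e n G).
Proof.
apply: min_sizeP.
have c2 (e : {set 'I_n}) : e \in [set e : {set 'I_n} | #|e| == 2] -> #|e| = 2.
  by rewrite inE => /eqP.
have li : {in [set e : {set 'I_n} | #|e| == 2] &,
            injective (fun e => nat_of_ord (enum_rank e))}.
  by move=> e1 e2 _ _ /val_inj/enum_rank_inj.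
exists (EOGraph c2 li) => e H' /eqP e2 /=.
by rewrite inE e2.
Qed.

Lemma sat_eP n (T : finType) (G : eograph T) :
  edges G != set0 -> is_min_size (@saturated T 'I_n G) (sat_e n G).
Proof.
move=> /set0Pn[d0 d0G]; apply: min_sizeP.
pose p m := `[< exists2 H : eograph 'I_n, ~ contains H G & #|edges H| = m >].
have exp : exists m, p m.
  have c2 (e : {set 'I_n}) : e \in set0 -> #|e| = 2 by rewrite inE.
  have li : {in set0 &, injective (fun e : {set 'I_n} => 0)}.
    by move=> e1 e2; rewrite inE.
  exists 0; apply/asboolP; exists (EOGraph c2 li); rewrite ?cards0 //.
  by move=> [f [_ /(_ _ d0G)]]; rewrite inE.
have ubp m : p m -> m <= #|{set 'I_n}|.
  by move=> /asboolP[H _ <-]; exact: max_card.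
case: (ex_maxnP exp ubp) => m /asboolP[H HG Hm] mmax.
exists H; split=> // e H' e2 eH [H'E H'l].
have [f [fi fE fl]] : contains H' G.
  apply: contrapT => nH'; have /mmax : p #|edges H'| by apply/asboolP; exists H'.
  by rewrite H'E cardsU1 eH Hm add1n ltnn.
exists f; first by split.
apply: contrapT => ne; apply: HG; exists f.
have fH d : d \in edges G -> f @: d \in edges H.
  move=> dG; have := fE _ dG; rewrite H'E !inE => /orP[/eqP fd|//].
  by case: ne; exists d.
by split=> // d1 d2 G1 G2; rewrite -H'l ?fH // fl.
Qed.

Section D0.

Let a : 'I_4 := @Ordinal 4 0 isT.
Let b : 'I_4 := @Ordinal 4 1 isT.
Let v : 'I_4 := @Ordinal 4 2 isT.
Let w : 'I_4 := @Ordinal 4 3 isT.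

(* In increasing order, so that the position in the list can serve as label. *)
Definition D0_edges : seq {set 'I_4} :=
  [:: [set a; b]; [set a; v]; [set a; w]; [set b; w]; [set b; v]].

Lemma D0_card_edge (e : {set 'I_4}) : e \in [set:: D0_edges] -> #|e| = 2.
Proof. by rewrite !inE => /or4P[|||/orP[]] /eqP ->; rewrite cards2. Qed.

Lemma D0_lab_inj : {in [set:: D0_edges] &, injective (index^~ D0_edges)}.
Proof.
move=> d1 d2; rewrite 2!(in_set (mem D0_edges)).
exact: (index_inj set0).
Qed.

Definition D0 : eograph 'I_4 := EOGraph D0_card_edge D0_lab_inj.

End D0.

(* Main.v *)
(* Take hubs x, y and z_1, ..., z_m with n <= m!, join every hub to every      *)
(* other vertex, and add the edge xy. Order the edges as follows: first the    *)
(* edges at x in the order of their other ends, then xy, then the edges at y,  *)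
(* and finally the edges u z_i in consecutive blocks indexed by u, each block  *)
(* ordered by its own permutation of the hubs z_i. The only triangles are      *)
(* those on xy, and xy is not the least edge of any of them, so there is no    *)
(* copy of D0. Let u precede v, both not hubs. The edge uv placed above uy     *)
(* gives the copy xu < xv < xy < uy < uv. Distinct permutations reverse some   *)
(* pair, so that u z_i < u z_j < v z_j < v z_i for some i, j, and uv placed    *)
(* below these edges gives another copy. Hence a maximal D0-free extension is  *)
(* saturated and all of its edges meet a hub, so it has at most (m + 2) n      *)
(* edges. The least m with n <= m! is O(log n / log log n).                    *)
Require Import Defs.
From HB Require Import structures.
From mathcomp Require Import all_boot all_fingroup zify.
From mathcomp Require Import boolp.

Set Implicit Arguments.
Unset Strict Implicit.
Unset Printing Implicit Defensive.

(** A maximal [D0]-free extension of the hub graph is saturated ([saturated_extension]), so no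
    saturated graph has to be written down. The hub graph is [D0]-free ([hub_graph_free]), and an
    edge between two non-hubs completes a copy wherever it sits in the order ([hub_graph_complete]).
    Hence every edge of the extension meets one of [m.+2] hubs, and [lt_fact_le] bounds the least
    [m] with [n <= m!]. *)

(** * Extensions and saturation *)

(** Labels may be renumbered, so inserting an edge at any position of an extension gives an
    extension again. *)
Definition extends (V : finType) (H0 H : eograph V) : Prop :=
  edges H0 \subset edges H /\
  {in edges H0 &, forall e1 e2, (lab H e1 < lab H e2) = (lab H0 e1 < lab H0 e2)}.

Lemma insertion_contains_using (T V : finType) (G : eograph T)
    (H H' : eograph V) (e : {set V}) :
  ~ contains H G -> insertion H e H' -> contains H' G -> contains_using H' G e.
Proof.
move=> HG [H'E H'l] [f [fi fE fl]]; exists f; first by split.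
apply: contrapT => ne; apply: HG; exists f.
have fH d : d \in edges G -> f @: d \in edges H.
  move=> dG; have := fE _ dG; rewrite H'E !inE => /orP[/eqP fd|//].
  by case: ne; exists d.
by split=> // d1 d2 G1 G2; rewrite -H'l ?fH // fl.
Qed.

(** Take a [G]-free extension with the most edges: any insertion is a larger extension, hence
    contains [G], and the copy must use the new edge. *)
Lemma saturated_extension (T V : finType) (G : eograph T) (H0 : eograph V) :
  ~ contains H0 G -> exists2 H, saturated G H & extends H0 H.
Proof.
move=> H0G.
pose p m := `[< exists2 H : eograph V,
  ~ contains H G /\ extends H0 H & #|edges H| = m >].
have exp : exists m, p m by exists #|edges H0|; apply/asboolP; exists H0.
have ubp m : p m -> m <= #|{set V}|.
  by move=> /asboolP[H _ <-]; exact: max_card.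
case: (ex_maxnP exp ubp) => m /asboolP[H [HG [H0H H0l]] Hm] mmax.
exists H => //; split=> // e H' e2 eH H'ins.
apply: insertion_contains_using (H'ins) _ => //.
apply: contrapT => nH'; have [H'E H'l] := H'ins.
have /mmax : p #|edges H'|.
  apply/asboolP; exists H' => //; split=> //; split.
    by rewrite H'E subsetU // H0H orbT.
  by move=> d1 d2 d1H d2H; rewrite H'l ?(subsetP H0H) // H0l.
by rewrite H'E cardsU1 eH Hm add1n ltnn.
Qed.

(** * Copies of [D0] as increasing lists of edges *)

Definition D0_image (V : finType) (a b v w : V) : seq {set V} :=
  [:: [set a; b]; [set a; v]; [set a; w]; [set b; w]; [set b; v]].

Lemma D0_edges_uniq : uniq D0_edges.
Proof. by rewrite /= !inE !eqEsubset !subUset !sub1set !inE. Qed.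

Lemma map_imset_D0_edges (V : finType) (f : 'I_4 -> V) :
  [seq f @: (d : {set 'I_4}) | d <- D0_edges] =
  D0_image (f (@Ordinal 4 0 isT)) (f (@Ordinal 4 1 isT))
           (f (@Ordinal 4 2 isT)) (f (@Ordinal 4 3 isT)).
Proof. by rewrite /D0_image /= !imsetU1 !imset_set1. Qed.

Lemma sorted_lab_D0 : sorted (relpre (lab D0) ltn) D0_edges.
Proof.
apply/(sortedP set0) => i i_lt.
change (index (nth set0 D0_edges i) D0_edges <
        index (nth set0 D0_edges i.+1) D0_edges).
by rewrite !index_uniq ?D0_edges_uniq ?(ltn_trans (ltnSn i) i_lt).
Qed.

(** Injectivity comes for free: adjacent vertices differ because edges have two elements, and
    [v = w] would make the second and third labels equal. *)
Lemma contains_D0P (V : finType) (H : eograph V) :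
  contains H D0 <-> exists a b v w,
    all (mem (edges H)) (D0_image a b v w) /\
    sorted ltn (map (lab H) (D0_image a b v w)).
Proof.
split=> [[f [fi fE fl]]|[a [b [v [w [abE abl]]]]]].
  exists (f (@Ordinal 4 0 isT)), (f (@Ordinal 4 1 isT)),
    (f (@Ordinal 4 2 isT)), (f (@Ordinal 4 3 isT)).
  rewrite -map_imset_D0_edges; split.
    by apply/allP => _ /mapP[d dE ->]; apply: fE; rewrite in_set.
  rewrite !sorted_map -(eq_in_sorted (P := mem D0_edges) (e := relpre (lab D0) ltn)).
  - exact: sorted_lab_D0.
  - by move=> d1 d2 d1E d2E; rewrite /= fl // in_set.
  - exact/allP.
pose f (i : 'I_4) := nth a [:: a; b; v; w] i.
have fimg : [seq f @: (d : {set 'I_4}) | d <- D0_edges] = D0_image a b v w.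
  by rewrite map_imset_D0_edges.
exists f; split.
- have ne x y : [set x; y] \in edges H -> x != y.
    by move/card_edge; rewrite cards2; case: eqP.
  have vw : v != w.
    by apply: contraTneq abl => ->; rewrite /= ltnn andbF.
  move: abE; rewrite /= => /and5P[/ne ab /ne av /ne aw /ne bw /andP[/ne bv _]].
  have un : uniq [:: a; b; v; w].
    by rewrite /= !inE !negb_or ab av aw bv bw vw.
  move=> i j /eqP; rewrite nth_uniq ?size_tuple // => [/eqP/val_inj //].
- move=> d; rewrite in_set => dE; apply: (allP abE).
  by rewrite -fimg; apply/mapP; exists d.
- move=> d1 d2; rewrite !in_set => d1E d2E.
  have lt_img x y : x \in D0_edges -> y \in D0_edges ->
      index x D0_edges < index y D0_edges ->
      lab H (f @: x) < lab H (f @: y).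
    move=> xE yE xy; move: abl; rewrite -fimg -map_comp sorted_map => abl.
    have tr : transitive 
        (relpre (fun d : {set 'I_4} => lab H (f @: d)) ltn).
      by move=> ? ? ? /=; apply: ltn_trans.
    exact: (sorted_ltn_index tr abl x y xE yE xy).
  case: (ltngtP (lab D0 d1) (lab D0 d2)) => [d12|d21|/D0_lab_inj d12].
  - exact: lt_img.
  - by apply/negbTE; rewrite -leqNgt ltnW // lt_img.
  - by rewrite d12 ?ltnn // in_set.
Qed.

(** * Permutations that pairwise reverse some pair *)

Lemma card_ord_lt m k : k <= m -> #|[set i : 'I_m | i < k]| = k.
Proof.
move=> km; rewrite -sum1_card; under eq_bigl do rewrite inE.
by rewrite -(big_ord_widen m (fun=> 1)) // sum1_card card_ord.
Qed.

(* Each order relation [p q |-> s p < s q] determines [s], as [s p] counts    *)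
(* the elements below [p].                                                    *)
Lemma perm_reversed_pair m (s t : {perm 'I_m}) :
  s <> t -> exists p q, s p < s q /\ t q < t p.
Proof.
move=> st; apply: contrapT => H; apply: st; apply/permP => p.
have card_lt (u : {perm 'I_m}) : #|[set q | u q < u p]| = u p.
  have -> : [set q | u q < u p] = u @^-1: [set i : 'I_m | i < u p].
    by apply/setP => q; rewrite !inE.
  by rewrite card_preimset ?card_ord_lt ?(ltnW (ltn_ord _)) //; exact: perm_inj.
apply: val_inj; rewrite /= -(card_lt s) -(card_lt t); apply: eq_card => q; rewrite !inE.
have [->|qp] := eqVneq q p; first by rewrite !ltnn.
have : s q != s p :> nat by rewrite (inj_eq val_inj) (inj_eq perm_inj).
have : t q != t p :> nat by rewrite (inj_eq val_inj) (inj_eq perm_inj).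
case: (ltngtP (s q) (s p)); case: (ltngtP (t q) (t p)) => // h1 h2 _ _.
- by case: H; exists q, p.
- by case: H; exists p, q.
Qed.

(** [r j] is a permutation of the numbers below [m], given on [nat] so that labels can be computed
    from it. *)
Definition reversing_ranks (n m : nat) (r : nat -> nat -> nat) : Prop :=
  [/\ forall j p, p < m -> r j p < m,
      forall j p q, p < m -> q < m -> r j p = r j q -> p = q &
      forall i j, i < n -> j < n -> i != j ->
        exists p q, [/\ p < m, q < m, r i p < r i q & r j q < r j p]].

Lemma reversing_ranks_exist n m : n <= m`! -> exists r, reversing_ranks n m r.
Proof.
move=> nm.
pose s j : {perm 'I_m} := nth 1%g (enum {perm 'I_m}) j.
have sz : size (enum {perm 'I_m}) = m`! by rewrite -cardE card_Sn.
pose r j p := if insub p is Some x then s j x : nat else 0.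
have rE j (p : 'I_m) : r j p = s j p by rewrite /r valK.
exists r; split=> [j p pm|j p q pm qm|i j i_n jn ij].
- by rewrite -[p]/(val (Ordinal pm)) rE.
- rewrite -[p]/(val (Ordinal pm)) -[q]/(val (Ordinal qm)) !rE.
  by move/val_inj/perm_inj => [].
- have [|p [q [pq qp]]] := @perm_reversed_pair _ (s i) (s j).
    by move/eqP; rewrite nth_uniq ?enum_uniq ?sz ?(leq_trans _ nm) //; apply/negP.
  by exists p, q; rewrite !rE.
Qed.

(** * The hub graph *)

(* Vertices below [m.+2] are the hubs: [0] is x, [1] is y and [p.+2] is z_p.  *)
Definition hub_adj (m i j : nat) : bool :=
  (i == 0) && (j == 1) || (i < m.+2 <= j).

(** Meant for edges with smaller end [i] and for [j < n]: the edges at 0 stay below [n], those at 1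
    below [2 * n], and beyond that vertex [j] owns a block of [m] labels. *)
Definition hub_lab (n m : nat) (r : nat -> nat -> nat) (i j : nat) : nat :=
  if i == 0 then (if j == 1 then n else j)
  else if i == 1 then n + j else 2 * n + (j * m + r j (i - 2)).

Lemma hub_lab_ge2 n m r i j :
  1 < i -> hub_lab n m r i j = 2 * n + (j * m + r j (i - 2)).
Proof. by case: i => [|[|]]. Qed.

Lemma hub_lab_0 n m r j : 1 < j -> hub_lab n m r 0 j = j.
Proof. by move=> j1; rewrite /hub_lab /= gtn_eqF. Qed.

Lemma hub_lab_1_lt n m r i j j' :
  1 < i -> j < n -> hub_lab n m r 1 j < hub_lab n m r i j'.
Proof. by move=> i1 jn; rewrite (hub_lab_ge2 _ _ _ _ i1) /hub_lab /=; lia. Qed.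

Lemma hub_lab_block_lt n m r i i' j j' : 1 < i -> 1 < i' ->
  r j (i - 2) < m -> j < j' -> hub_lab n m r i j < hub_lab n m r i' j'.
Proof. by move=> i1 i1' rm jj'; rewrite !hub_lab_ge2 //; nia. Qed.

Section HubGraph.
Variables (n m : nat) (r : nat -> nat -> nat).
Hypothesis r_rev : reversing_ranks n m r.

Definition hub_edges : {set {set 'I_n}} :=
  [set [set p.1; p.2] | p : 'I_n * 'I_n & hub_adj m p.1 p.2].

(** The maximum only selects a value: [hub_adj] forces [p.1 < p.2], so an edge comes from a single
    pair. *)
Definition hub_edge_lab (e : {set 'I_n}) : nat :=
  \max_(p : 'I_n * 'I_n | hub_adj m p.1 p.2 && (e == [set p.1; p.2]))
    hub_lab n m r p.1 p.2.

Lemma hub_adj_lt i j : hub_adj m i j -> i < j.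
Proof. by rewrite /hub_adj; lia. Qed.

Lemma set2_ord_inj (i j i' j' : 'I_n) :
  i < j -> i' < j' -> [set i; j] = [set i'; j'] -> i = i' /\ j = j'.
Proof.
move=> ij ij' E.
have := set21 i j; have := set22 i j; rewrite {1 2}E !inE.
by do 2 ![case/orP=> /eqP ?]; subst => //; move: ij ij'; lia.
Qed.

Lemma hub_edgesP e : reflect (exists i j : 'I_n, hub_adj m i j /\ e = [set i; j])
  (e \in hub_edges).
Proof.
apply: (iffP imsetP) => [[[i j]]|[i [j [ij ->]]]]; rewrite ?inE => /=.
  by exists i, j.
by exists (i, j); rewrite ?inE.
Qed.

Lemma hub_edge_set2 (i j : 'I_n) :
  ([set i; j] \in hub_edges) = hub_adj m i j || hub_adj m j i.
Proof.
apply/hub_edgesP/orP => [[x [y [xy E]]]|[ij|ji]]; last first.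
- by exists j, i; rewrite setUC.
- by exists i, j.
have := set21 x y; have := set22 x y; rewrite -!E !inE.
move=> /orP[] /eqP ? /orP[] /eqP ?; subst; try by [left|right].
- by move/hub_adj_lt: xy; rewrite ltnn.
- by move/hub_adj_lt: xy; rewrite ltnn.
Qed.

Lemma hub_edge_labE (i j : 'I_n) :
  hub_adj m i j -> hub_edge_lab [set i; j] = hub_lab n m r i j.
Proof.
move=> ij; rewrite /hub_edge_lab (big_pred1 (i, j)) // => -[x y] /=.
apply/andP/eqP => [[xy /eqP E]|[-> ->]]; last by [].
by have [-> ->] := set2_ord_inj (hub_adj_lt ij) (hub_adj_lt xy) E.
Qed.

Lemma hub_card_edge (e : {set 'I_n}) : e \in hub_edges -> #|e| = 2.
Proof.
move=> /hub_edgesP[i [j [/hub_adj_lt ij ->]]].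
by rewrite cards2; case: eqVneq ij => // ->; rewrite ltnn.
Qed.

Lemma hub_lab_inj : {in hub_edges &, injective hub_edge_lab}.
Proof.
case: r_rev => r_lt r_inj _.
move=> _ _ /hub_edgesP[i [j [ij ->]]] /hub_edgesP[i' [j' [ij' ->]]].
rewrite !hub_edge_labE // => labE.
suff [/val_inj -> /val_inj ->] : i = i' :> nat /\ j = j' :> nat by [].
have := ltn_ord j; have := ltn_ord j'.
have := r_lt j (i - 2); have := r_lt j' (i' - 2).
move: ij ij'; rewrite /hub_adj => ij ij'.
case: (ltnP i 2) => i2; case: (ltnP i' 2) => i2';
  try by move: labE; rewrite /hub_lab; do 4 ?case: ifP; lia.
move=> rj' rj _ _; move: labE; rewrite !hub_lab_ge2 // => E.
(* Ranks are below [m], so equal labels lie in the same block. *)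
have jj' : j = j' :> nat by nia.
suff : i - 2 = i' - 2 by lia.
by apply: (r_inj j); [lia|lia|move: E; rewrite jj'; lia].
Qed.

Definition hub_graph : eograph 'I_n := EOGraph hub_card_edge hub_lab_inj.

(* All triangles contain the edge [01], which is not minimal in any of them.  *)
Lemma hub_graph_free : ~ contains hub_graph D0.
Proof.
have no01 (x y z : 'I_n) : x = 0 :> nat -> y = 1 :> nat ->
    hub_adj m x z || hub_adj m z x -> y != z :> nat ->
    hub_edge_lab [set x; z] > hub_edge_lab [set x; y] -> False.
  move=> x0 y1 xz yz.
  have {}xz : hub_adj m x z by move: xz; rewrite /hub_adj x0; lia.
  have xy : hub_adj m x y by rewrite /hub_adj x0 y1.
  rewrite !hub_edge_labE // /hub_lab x0 y1 /=.
  by have := ltn_ord z; case: eqP; lia.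
move=> /contains_D0P[a [b [v [w []]]]] /=.
rewrite !hub_edge_set2 => /and5P[ab av aw bw /andP[bv _]].
move=> /and5P[l1 l2 l3 l4 _].
have vw : v != w :> nat.
  by apply: contraTneq l2 => /val_inj ->; rewrite ltnn.
have l5 := ltn_trans l1 (ltn_trans l2 (ltn_trans l3 l4)).
(* If ab is not the edge 01, both triangles abv and abw contain 01 only when [v = w]. *)
have [[a0 b1]|[[a1 b0]|nab]] : (a = 0 :> nat /\ b = 1 :> nat) \/
    (a = 1 :> nat /\ b = 0 :> nat) \/ ~ (a < 2 /\ b < 2).
- by move: ab; rewrite /hub_adj; lia.
- by apply: (no01 a b v) => //; move: bv; rewrite /hub_adj; lia.
- apply: (no01 b a v) => //; last by rewrite setUC.
  by move: av; rewrite /hub_adj; lia.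
- by move: ab av aw bw bv; rewrite /hub_adj; lia.
Qed.

(** Edges at hub 1 precede all edges at the later hubs, so any position of uv is above the edge from
    1 to [u] or below the edges needed for the second copy. *)
Lemma hub_graph_complete H (u v : 'I_n) :
  extends hub_graph H -> m.+2 <= u -> u < v -> [set u; v] \in edges H ->
  contains H D0.
Proof.
case: r_rev => r_lt _ rev [H0H H0l] mu uv uvH.
have [|p [q [pm qm pq qp]]] := rev u v (ltn_ord u) (ltn_ord v).
  by rewrite ltn_eqF.
have hub i : i < m.+2 -> exists x : 'I_n, x = i :> nat.
  move=> im; suff i_n : i < n by exists (Ordinal i_n).
  by have := ltn_ord u; lia.
(* Here [x] and [y] are the hubs of the reversed pair, while [z] and [z'] are the hubs 0 and 1. *)
have [x xE] := hub p.+2 pm; have [y yE] := hub q.+2 qm.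
have [z zE] := hub 0 isT; have [z' z'E] := hub 1 isT.
have edge (i j : 'I_n) : hub_adj m i j -> [set i; j] \in edges H.
  by move=> ij; apply: (subsetP H0H); rewrite hub_edge_set2 ij.
have lab_lt (i j i' j' : 'I_n) : hub_adj m i j -> hub_adj m i' j' ->
    hub_lab n m r i j < hub_lab n m r i' j' ->
    lab H [set i; j] < lab H [set i'; j'].
  by move=> ij ij'; rewrite H0l /= ?hub_edge_labE // hub_edge_set2 ?ij ?ij'.
have adj (i j : 'I_n) : i < m.+2 -> u <= j -> hub_adj m i j.
  by rewrite /hub_adj; lia.
have zz' : hub_adj m z z' by rewrite /hub_adj zE z'E.
have [zu zv z'u] : [/\ hub_adj m z u, hub_adj m z v & hub_adj m z' u].
  by rewrite !adj ?zE ?z'E // ltnW.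
have [xu xv yu yv] :
    [/\ hub_adj m x u, hub_adj m x v, hub_adj m y u & hub_adj m y v].
  by rewrite !adj ?xE ?yE // ltnW.
have u1 : 1 < u by exact: leq_trans mu.
have v1 := ltn_trans u1 uv.
apply/contains_D0P.
have xuuv : lab H [set x; u] != lab H [set u; v].
  apply: contraTneq (edge _ _ xu) => /(lab_inj (edge _ _ xu) uvH) E.
  have : x \in [set u; v] by rewrite -E set21.
  have xu_lt : x < u by rewrite xE; apply: leq_trans mu.
  by rewrite !inE -!val_eqE /= !ltn_eqF // (ltn_trans xu_lt).
have [le_xu|gt_xu] := ltnP (lab H [set x; u]) (lab H [set u; v]).
  have lt_uv : lab H [set z'; u] < lab H [set u; v].
    by apply: ltn_trans le_xu; rewrite lab_lt // xE z'E hub_lab_1_lt.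
  exists z, u, v, z'; rewrite /= (setUC [set u] [set z']) uvH lt_uv !edge //.
  rewrite !lab_lt // ?zE ?z'E.
  - by rewrite /hub_lab /= -[X in X < _]addn0 ltn_add2l ltnW.
  - by rewrite hub_lab_0 // /hub_lab.
  - by rewrite !hub_lab_0.
have lt_xu : lab H [set u; v] < lab H [set x; u].
  by rewrite ltn_neqAle eq_sym xuuv.
exists u, v, x, y; rewrite /= (setUC [set u] [set x]) (setUC [set u] [set y]).
rewrite (setUC [set v] [set x]) (setUC [set v] [set y]) uvH lt_xu !edge //.
rewrite !lab_lt // ?xE ?yE.
- by rewrite !hub_lab_ge2 // !subn2 !ltn_add2l.
- by rewrite hub_lab_block_lt // subn2 r_lt.
- by rewrite !hub_lab_ge2 // !subn2 !ltn_add2l.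
Qed.

End HubGraph.

(** * Counting edges *)

Lemma D0_edges_neq0 : edges D0 != set0.
Proof.
apply/set0Pn; exists [set @Ordinal 4 0 isT; @Ordinal 4 1 isT].
by rewrite !inE eqxx.
Qed.

Lemma sat_D0_le n m : n <= m`! -> sat_e n D0 <= m.+2 * n.
Proof.
move=> /reversing_ranks_exist[r r_rev].
have [H Hsat H0H] := saturated_extension (@hub_graph_free _ _ _ r_rev).
have [_ /(_ _ Hsat) /leq_trans] := sat_eP n D0_edges_neq0; apply.
pose hubs := [set i : 'I_n | i < m.+2].
have hubs_le : #|hubs| <= m.+2.
  have [mn|/ltnW nm] := leqP m.+2 n; first by rewrite card_ord_lt.
  by rewrite (leq_trans (max_card _)) // card_ord.
have sub : edges H \subset [set [set p.1; p.2] | p in setX hubs [set: 'I_n]].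
  apply/subsetP => e eH; have /eqP/cards2P[i [j [ij eE]]] := card_edge eH.
  subst e; apply/imsetP.
  wlog lt_ij : i j ij eH / i < j.
    move=> wl; case: (ltngtP i j) (ij) => [||/val_inj ->]; rewrite ?eqxx //.
      by move=> lt_ij _; apply: wl.
    by move=> lt_ji _; rewrite setUC; apply: wl => //; rewrite 1?eq_sym // setUC.
  (* If the smaller end is not a hub, neither end is, and a copy of [D0] appears. *)
  have [im|mi] := ltnP i m.+2; first by exists (i, j); rewrite // !inE im.
  by case: Hsat => -[]; exact: (hub_graph_complete H0H mi lt_ij eH).
apply: leq_trans (subset_leq_card sub) _.
apply: leq_trans (leq_imset_card _ _) _.
by rewrite cardsX cardsT card_ord leq_mul2r hubs_le orbT.
Qed.

Lemma ssat_le_sat n (T : finType) (G : eograph T) :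
  edges G != set0 -> ssat_e n G <= sat_e n G.
Proof.
move=> /(sat_eP n)[[H [_ Hss] <-] _].
by have [_] := ssat_eP n G; apply.
Qed.

From mathcomp Require Import all_order all_algebra ring lra.
From mathcomp Require Import all_classical all_reals all_analysis.

Import Order.TTheory GRing.Theory Num.Theory numFieldNormedType.Exports.
Local Open Scope classical_set_scope.
Local Open Scope ring_scope.

(** * Asymptotics *)

(** With L = ln n and t = ln L, suppose q > e L / t. As t <= exp(t/2), q >= exp(1 + t/2), so exp((1
    + t/2) q) <= q^q <= e^q q! <= exp(q + L). Thus q t <= 2 L, against q t > e L. *)
Lemma lt_fact_le (R : realType) (n q : nat) :
  1 < ln n%:R :> R -> (q`! < n)%N ->
  q%:R <= expR 1 * (ln n%:R / ln (ln n%:R)) :> R.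
Proof.
set L := ln n%:R => L1 qn; set t := ln L.
have L0 : 0 < L by exact: lt_trans L1.
have t0 : 0 < t by rewrite ln_gt0.
have LE : L = expR t by rewrite lnK.
have nE : n%:R = expR L.
  by rewrite lnK // posrE ltr0n (leq_ltn_trans _ qn).
have e2 : 2 <= expR 1 :> R by have := expR_ge1Dx (1 : R); lra.
rewrite leNgt; apply/negP => q_gt.
have t_le : t <= expR (t / 2).
  have -> : t / 2 = t / 4 + t / 4 by field.
  rewrite expRD -expr2; apply: le_trans (_ : (1 + t / 4) ^+ 2 <= _).
    by have := sqr_ge0 (1 - t / 4); lra.
  by rewrite lerXn2r ?nnegrE ?expR_ge0 ?expR_ge1Dx //; lra.
have q_ge : expR (1 + t / 2) <= q%:R.
  apply: le_trans (ltW q_gt); rewrite expRD ler_pM2l ?expR_gt0 //.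
  rewrite ler_pdivlMr // LE [X in _ <= expR X](_ : t = t / 2 + t / 2).
    by rewrite expRD ler_pM2l ?expR_gt0.
  by field.
have q0 : (0 < q)%N by rewrite -(ltr0n R) (lt_le_trans _ q_ge) ?expR_gt0.
have : expR ((1 + t / 2) * q%:R) <= expR (q%:R + L).
  rewrite expRD -nE expRM_natr.
  apply: le_trans (_ : q%:R ^+ q <= _); first by rewrite lerXn2r ?nnegrE ?expR_ge0.
  (* q^q / q! is one term of the series of e^q. *)
  have := @expR_ge1Dxn R q%:R q.-1 (ler0n _ _); rewrite prednK // => qe.
  have f0 : 0 < q`!%:R :> R by rewrite ltr0n fact_gt0.
  have : q%:R ^+ q / q`!%:R <= expR q%:R :> R by lra.
  rewrite ler_pdivrMr // => /le_trans; apply.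
  by rewrite ler_pM2l ?expR_gt0 // ler_nat ltnW.
rewrite ler_expR => le1.
move: q_gt; rewrite mulrA ltr_pdivrMr // => q_gt.
have : 2 * L <= expR 1 * L by rewrite ler_pM2r.
lra.
Qed.

Theorem theorem54 (R : realType) :
  (forall n : nat, (ssat_e n D0 <= sat_e n D0)%N) /\
  (fun n : nat => (sat_e n D0)%:R : R) =O_\oo
    (fun n : nat => n%:R * (ln n%:R / ln (ln n%:R)) : R).
Proof.
split=> [n|]; first exact: ssat_le_sat D0_edges_neq0.
(* The least [m] is q + 1 with q! < n, and (q + 3) n <= (e x + 3) n <= (e + 3) x n since x >= 1. *)
apply/eqO_exP; exists (expR 1 + 3); first by rewrite addr_gt0 ?expR_gt0.
near=> n.
have n_gt : expR 1 < n%:R :> R by near: n; exact: nbhs_infty_gtr.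
have n0 : 0 < n%:R :> R := lt_trans (expR_gt0 1) n_gt.
set x := ln n%:R / ln (ln n%:R).
have L1 : 1 < ln n%:R :> R by rewrite -ltr_expR lnK.
have x1 : 1 <= x.
  by rewrite ler_pdivlMr ?ln_gt0 // mul1r ltW // ln_sublinear // (lt_trans _ L1).
have exm : exists m, (n <= m`!)%N by exists n; exact: fact_geq.
case: (ex_minnP exm) => -[|q] nm qmin.
  have := ln_le0 (_ : n%:R <= 1 :> R); rewrite (ler_nat R n 1) => /(_ nm); lra.
have qx : q%:R <= expR 1 * x.
  apply: lt_fact_le => //; rewrite ltnNge; apply/negP => /qmin.
  by rewrite ltnn.
rewrite ger0_norm // ger0_norm; last by rewrite mulr_ge0 // (le_trans ler01).
apply: le_trans (_ : (q.+3 * n)%:R <= _); first by rewrite ler_nat sat_D0_le.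
rewrite natrM mulrCA mulrC ler_pM2l // -addn3 natrD; nra.
Unshelve. all: by end_near.
Qed.
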